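(* Let $F:\mathbb{R}^n\times\mathbb{R}^m\to\mathbb{R}$ and $G:\mathbb{R}^n\times\mathbb{R}^m\to\mathbb{R}^p$ be continuously differentiable, and let $f:\mathbb{R}^n\times\mathbb{R}^m\to\mathbb{R}$ and $g:\mathbb{R}^n\times\mathbb{R}^m\to\mathbb{R}^q$ be twice continuously differentiable. The following statements hold, where the systems $\mathrm{K}_\lambda$ and $\mathrm{V}_\lambda$ are the stationarity systems (of the KKT and the lower-level value function reformulation, respectively) written out in the context. (i) Let $\lambda>0$ and suppose that $(x,y,\omega,s,u,v,t)\in\mathbb{R}^n\times\mathbb{R}^m\times\mathbb{R}^q\times\mathbb{R}^m\times\mathbb{R}^p\times\mathbb{R}^q\times\mathbb{R}^q$ satisfies $\mathrm{K}_\lambda$ (that is, $\mathrm{K}_\lambda$ with $z:=\omega$ and $w:=t$), and that $\omega^\top g(x,y)=0$ and $\nabla_{1,2}(\nabla_2\ell)(x,y,\omega)=0$. Then $\mathrm{V}_\lambda$ is satisfied by $x$, $y$, $u$, $v$ together with $z:=y$ and $w:=\omega$. (ii) Let $\lambda>0$ and suppose that $x\in\mathbb{R}^n$, $y\in\mathbb{R}^m$, $u\in\mathbb{R}^p$, $v\in\mathbb{R}^q$, $\omega\in\mathbb{R}^q$ are such that $\mathrm{V}_\lambda$ is satisfied by $x,y,u,v$ together with $z:=y$ and $w:=\omega$. Suppose also that $\nabla_{1,2}(\nabla_2\ell)(x,y,\omega)=0$ and that there exists $s\in\mathbb{R}^m$ such that $$\nabla_2 g(x,y)s-\lambda g(x,y)\ge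 0\quad\text{and}\quad \omega^\top\nabla_2 g(x,y)s=0 .$$ Then there exists $t\in\mathbb{R}^q$ such that $(x,y,\omega,s,u,v,t)$ satisfies $\mathrm{K}_\lambda$ (that is, $\mathrm{K}_\lambda$ with $z:=\omega$ and $w:=t$).
   Context: Notation. Vector inequalities are componentwise. $\ell(x,y,z):=f(x,y)+z^\top g(x,y)$. $\nabla_1$, $\nabla_2$ denote gradients (Jacobians, with rows the transposed component gradients, for vector-valued functions) with respect to the first variable and the second variable respectively, and $\nabla$ applied to a function of $(x,y)$ denotes the gradient (Jacobian) with respect to $(x,y)$. $\nabla_{1,2}(\nabla_2\ell)(x,y,z)\in\mathbb{R}^{m\times(n+m)}$ is the Jacobian of $\nabla_2\ell$ with respect to its first two variables $(x,y)$. System $\mathrm{K}_\lambda$ in the unknowns $(x,y,z,s,u,v,w)\in\mathbb{R}^n\times\mathbb{R}^m\times\mathbb{R}^q\times\mathbb{R}^m\times\mathbb{R}^p\times\mathbb{R}^q\times\mathbb{R}^q$: \begin{align*} &\nabla F(x,y)+\nabla G(x,y)^\top u+\nabla g(x,y)^\top (v-\lambda z)+\nabla_{1,2}(\nabla_2\ell)(x,y,z)^\top s=0,\\ &\nabla_2 f(x,y)+\nabla_2 g(x,y)^\top z=0,\\ &-\lambda g(x,y)+\nabla_2 g(x,y)\,s+w=0,\\ &u\ge 0,\ G(x,y)\le 0,\ u^\top G(x,y)=0,\\ &v\ge 0,\ g(x,y)\le 0,\ v^\top g(x,y)=0,\\ &w\le 0,\ z\ge 0,\ w^\top z=0. \end{align*}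 System $\mathrm{V}_\lambda$ in the unknowns $(x,y,z,u,v,w)\in\mathbb{R}^n\times\mathbb{R}^m\times\mathbb{R}^m\times\mathbb{R}^p\times\mathbb{R}^q\times\mathbb{R}^q$: \begin{align*} &\nabla F(x,y)+\nabla G(x,y)^\top u+\nabla g(x,y)^\top v+\lambda\nabla f(x,y)-\lambda\begin{bmatrix}\nabla_1\ell(x,z,w)\\ 0\end{bmatrix}=0,\\ &\nabla_2 f(x,z)+\nabla_2 g(x,z)^\top w=0,\\ &u\ge 0,\ G(x,y)\le 0,\ u^\top G(x,y)=0,\\ &v\ge 0,\ g(x,y)\le 0,\ v^\top g(x,y)=0,\\ &w\ge 0,\ g(x,z)\le 0,\ w^\top g(x,z)=0. \end{align*} Here $0$ in the block vector is the zero vector of $\mathbb{R}^m$. *)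

(* Defs.v *)
From HB Require Import structures.
From mathcomp Require Import all_boot all_order all_algebra.
From mathcomp Require Import all_classical all_reals all_analysis.

Set Implicit Arguments.
Unset Strict Implicit.
Unset Printing Implicit Defensive.

Import Order.TTheory GRing.Theory Num.Theory.
Import numFieldNormedType.Exports.

Local Open Scope classical_set_scope.
Local Open Scope ring_scope.

Definition vle (R : realType) k (a b : 'cV[R]_k) : Prop :=
  forall i, a i 0 <= b i 0.

Notation "a <=v b" := (vle a b) (at level 70, no associativity) : ring_scope.

Definition dot (R : realType) k (a b : 'cV[R]_k) : R := (a^T *m b) 0 0.

(* On a finite-dimensional V, continuity of p |-> 'd h p in operator norm is
   the same as continuity of p |-> 'd h p v for each fixed v. *)
Definition C1 (R : realType) (V W : normedModType R) (h : V -> W) : Prop :=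
  (forall p, differentiable h p) /\
  (forall v, continuous (fun p => 'd h p v)).

Definition C2 (R : realType) (V W : normedModType R) (h : V -> W) : Prop :=
  C1 h /\ (forall v, C1 (fun p => 'd h p v)).

Definition grad (R : realType) k (h : 'cV[R]_k -> R) (a : 'cV[R]_k) :
    'cV[R]_k :=
  \col_(j < k) 'D_(delta_mx j 0) h a.

(* The rows are the transposed gradients of the components; this is the
   transpose of the convention of the library's [jacobian], which acts on row
   vectors. *)
Definition jac (R : realType) k l (h : 'cV[R]_k -> 'cV[R]_l) (a : 'cV[R]_k) :
    'M[R]_(l, k) :=
  \matrix_(i < l) (grad (fun b => h b i 0) a)^T.

Section TwoVariables.
Variables (R : realType) (n m : nat).

Local Notation XY := ('cV[R]_n * 'cV[R]_m)%type.

Definition grad1 (h : XY -> R) (a : XY) : 'cV[R]_n :=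
  grad (fun x => h (x, a.2)) a.1.

Definition grad2 (h : XY -> R) (a : XY) : 'cV[R]_m :=
  grad (fun y => h (a.1, y)) a.2.

Definition jac2 l (h : XY -> 'cV[R]_l) (a : XY) : 'M[R]_(l, m) :=
  jac (fun y => h (a.1, y)) a.2.

(* Derivatives with respect to (x, y) are taken after identifying
   R^n * R^m with R^(n + m) by stacking y below x. *)
Definition grad12 (h : XY -> R) (a : XY) : 'cV[R]_(n + m) :=
  grad (fun b : 'cV[R]_(n + m) => h (usubmx b, dsubmx b)) (col_mx a.1 a.2).

Definition jac12 l (h : XY -> 'cV[R]_l) (a : XY) : 'M[R]_(l, n + m) :=
  jac (fun b : 'cV[R]_(n + m) => h (usubmx b, dsubmx b)) (col_mx a.1 a.2).

(* [lagr f g z (x, y)] is l(x, y, z). *)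
Definition lagr q (f : XY -> R) (g : XY -> 'cV[R]_q) (z : 'cV[R]_q)
    (a : XY) : R :=
  f a + dot z (g a).

Record systemK p q (F : XY -> R) (G : XY -> 'cV[R]_p) (f : XY -> R)
    (g : XY -> 'cV[R]_q) (lambda : R) (x : 'cV[R]_n) (y : 'cV[R]_m)
    (z : 'cV[R]_q) (s : 'cV[R]_m) (u : 'cV[R]_p) (v w : 'cV[R]_q) : Prop :=
  SystemK {
    K_stationarity :
      grad12 F (x, y) + (jac12 G (x, y))^T *m u
        + (jac12 g (x, y))^T *m (v - lambda *: z)
        + (jac12 (grad2 (lagr f g z)) (x, y))^T *m s = 0;
    K_lower_stationarity :
      grad2 f (x, y) + (jac2 g (x, y))^T *m z = 0;
    K_multiplier :
      - (lambda *: g (x, y)) + jac2 g (x, y) *m s + w = 0;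
    K_compl_u : [/\ 0 <=v u, G (x, y) <=v 0 & dot u (G (x, y)) = 0];
    K_compl_v : [/\ 0 <=v v, g (x, y) <=v 0 & dot v (g (x, y)) = 0];
    K_compl_w : [/\ w <=v 0, 0 <=v z & dot w z = 0]
  }.

Record systemV p q (F : XY -> R) (G : XY -> 'cV[R]_p) (f : XY -> R)
    (g : XY -> 'cV[R]_q) (lambda : R) (x : 'cV[R]_n) (y z : 'cV[R]_m)
    (u : 'cV[R]_p) (v w : 'cV[R]_q) : Prop :=
  SystemV {
    V_stationarity :
      grad12 F (x, y) + (jac12 G (x, y))^T *m u + (jac12 g (x, y))^T *m v
        + lambda *: grad12 f (x, y)
        - lambda *: col_mx (grad1 (lagr f g w) (x, z)) 0 = 0;
    V_lower_stationarity :
      grad2 f (x, z) + (jac2 g (x, z))^T *m w = 0;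
    V_compl_u : [/\ 0 <=v u, G (x, y) <=v 0 & dot u (G (x, y)) = 0];
    V_compl_v : [/\ 0 <=v v, g (x, y) <=v 0 & dot v (g (x, y)) = 0];
    V_compl_w : [/\ 0 <=v w, g (x, z) <=v 0 & dot w (g (x, z)) = 0]
  }.

End TwoVariables.

(* Main.v *)
(* Lower-level stationarity says that grad2 of the Lagrangian l vanishes, so the
   block vector (grad1 l, 0) is the full gradient of l in (x, y), namely
   grad12 f + (jac12 g)^T z. Once the second-order term is dropped, the
   stationarity conditions of K and V with z := y therefore coincide. In (ii),
   the multiplier equation forces t := lambda g - (jac2 g) s. *)
Require Import Defs.
From HB Require Import structures.
From mathcomp Require Import all_boot all_order all_algebra.
From mathcomp Require Import all_classical all_reals all_analysis.

Set Implicit Arguments.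
Unset Strict Implicit.
Unset Printing Implicit Defensive.

Import Order.TTheory GRing.Theory Num.Theory.
Import numFieldNormedType.Exports.

Local Open Scope classical_set_scope.
Local Open Scope ring_scope.

Section PartialGradients.
Variables (R : realType) (n m : nat).

Local Notation XY := ('cV[R]_n * 'cV[R]_m)%type.

(** Both derivatives are limits of the same difference quotient, so no differentiability of [h] is
    required. This turns derivatives along slices, or through stacking, into directional derivatives
    on the product space, where they can be compared. *)
Lemma derive_comp_affine (V U W : normedModType R) (h : U -> W) (phi : V -> U)
    (a v : V) (dv : U) :
  (forall t, phi (t *: v + a) = t *: dv + phi a) ->
  'D_v (h \o phi) a = 'D_dv h (phi a).
Proof.
move=> phi_affine; rewrite /derive; congr (lim (_ @ 0^')).
by apply/funext => t /=; rewrite phi_affine.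
Qed.

Arguments derive_comp_affine {V U W h phi a v dv}.

Lemma grad1E (h : XY -> R) (a : XY) :
  grad1 h a = \col_j 'D_(delta_mx j 0, 0) h a.
Proof.
apply/matrixP => j k; rewrite !mxE; case: a => a1 a2 /=.
apply: (derive_comp_affine (h := h) (phi := fun x => (x, a2))) => t.
by apply: injective_projections => //=; rewrite scaler0 add0r.
Qed.

Lemma grad2E (h : XY -> R) (a : XY) :
  grad2 h a = \col_j 'D_(0, delta_mx j 0) h a.
Proof.
apply/matrixP => j k; rewrite !mxE; case: a => a1 a2 /=.
apply: (derive_comp_affine (h := h) (phi := fun y => (a1, y))) => t.
by apply: injective_projections => //=; rewrite scaler0 add0r.
Qed.

Lemma grad12E (h : XY -> R) (a : XY) :
  grad12 h a =
    \col_j 'D_(usubmx (delta_mx j 0), dsubmx (delta_mx j 0)) h a.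
Proof.
apply/matrixP => j k; rewrite !mxE; case: a => a1 a2 /=.
rewrite (derive_comp_affine (h := h) (phi := fun b => (usubmx b, dsubmx b))
  (dv := (usubmx (delta_mx j 0), dsubmx (delta_mx j 0)))) ?col_mxKu ?col_mxKd //.
by move=> t; apply: injective_projections;
  rewrite /= linearD linearZ /= ?col_mxKu ?col_mxKd.
Qed.

(** Each basis vector of the stacked space splits into a basis vector in one block and zero in the
    other, so every entry is the same directional derivative on both sides. *)
Lemma grad12_col_mx (h : XY -> R) (a : XY) :
  grad12 h a = col_mx (grad1 h a) (grad2 h a).
Proof.
rewrite grad12E grad1E grad2E; apply/matrixP => j k; rewrite !mxE.
case: splitP => i ij; rewrite mxE; congr (derive h a _).
- have -> : j = lshift m i by exact: val_inj.
  by rewrite delta_mx_ushift col_mxKu col_mxKd.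
- have -> : j = rshift n i by exact: val_inj.
  by rewrite delta_mx_dshift col_mxKu col_mxKd.
Qed.

(** For fixed [z] the Lagrangian is [f] plus a linear combination of the components of [g]. Keeping
    the direction [v] arbitrary serves both the full gradient and the one in [y]. *)
Lemma derive_lagr q (f : XY -> R) (g : XY -> 'cV[R]_q) z (a v : XY) :
  differentiable f a -> differentiable g a ->
  'D_v (lagr f g z) a =
    'D_v f a + \sum_i z i 0 * 'D_v (fun b => g b i 0) a.
Proof.
move=> df dg.
have dgi i : derivable (fun b => g b i 0) a v.
  by apply: (derivable_mxP _ _ _).1; exact: diff_derivable.
have -> : lagr f g z = f + \sum_i (z i 0 \*: (fun b => g b i 0 : R)).
  apply/funext => b; rewrite /lagr /dot mxE fctE /=; congr (_ + _).
  by rewrite fct_sumE; apply: eq_bigr => i _; rewrite mxE.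
rewrite deriveD; first last.
- by apply: derivable_sum => i; exact: derivableZ.
- exact: diff_derivable.
rewrite derive_sum; last by move=> i; exact: derivableZ.
by congr (_ + _); apply: eq_bigr => i _; rewrite deriveZ.
Qed.

Lemma grad12_lagr q (f : XY -> R) (g : XY -> 'cV[R]_q) z (a : XY) :
  differentiable f a -> differentiable g a ->
  grad12 (lagr f g z) a = grad12 f a + (jac12 g a)^T *m z.
Proof.
move=> df dg; rewrite !grad12E; apply/matrixP => j k.
rewrite !mxE derive_lagr //; congr (_ + _); apply: eq_bigr => i _.
(* Row [i] of [jac12 g a] is by definition the transposed [grad12] of component [i], so its entries
   are directional derivatives too. *)
have /matrixP/(_ j 0) := grad12E (fun b => g b i 0) a.
by rewrite !mxE ord1 mulrC => ->.
Qed.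

Lemma grad2_lagr q (f : XY -> R) (g : XY -> 'cV[R]_q) z (a : XY) :
  differentiable f a -> differentiable g a ->
  grad2 (lagr f g z) a = grad2 f a + (jac2 g a)^T *m z.
Proof.
move=> df dg; rewrite !grad2E; apply/matrixP => j k.
rewrite !mxE derive_lagr //; congr (_ + _); apply: eq_bigr => i _.
have /matrixP/(_ j 0) := grad2E (fun b => g b i 0) a.
by rewrite !mxE ord1 mulrC => ->.
Qed.

Lemma col_mx_grad1_lagr q (f : XY -> R) (g : XY -> 'cV[R]_q) z (a : XY) :
  differentiable f a -> differentiable g a ->
  grad2 f a + (jac2 g a)^T *m z = 0 ->
  col_mx (grad1 (lagr f g z) a) 0 = grad12 f a + (jac12 g a)^T *m z.
Proof.
by move=> df dg st; rewrite -grad12_lagr // grad12_col_mx grad2_lagr // st.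
Qed.

End PartialGradients.

Lemma dotC (R : realType) k (a b : 'cV[R]_k) : dot a b = dot b a.
Proof. by rewrite /dot -(trmxK (a^T *m b)) trmx_mul trmxK mxE. Qed.

Theorem theorem3p5 (R : realType) (n m p q : nat)
    (F : 'cV[R]_n * 'cV[R]_m -> R) (G : 'cV[R]_n * 'cV[R]_m -> 'cV[R]_p)
    (f : 'cV[R]_n * 'cV[R]_m -> R) (g : 'cV[R]_n * 'cV[R]_m -> 'cV[R]_q)
    (F_C1 : C1 F) (G_C1 : C1 G) (f_C2 : C2 f) (g_C2 : C2 g) :
  (forall (lambda : R) (x : 'cV[R]_n) (y : 'cV[R]_m) (omega : 'cV[R]_q)
      (s : 'cV[R]_m) (u : 'cV[R]_p) (v t : 'cV[R]_q),
    0 < lambda ->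
    systemK F G f g lambda x y omega s u v t ->
    dot omega (g (x, y)) = 0 ->
    jac12 (grad2 (lagr f g omega)) (x, y) = 0 ->
    systemV F G f g lambda x y y u v omega)
  /\
  (forall (lambda : R) (x : 'cV[R]_n) (y : 'cV[R]_m) (u : 'cV[R]_p)
      (v omega : 'cV[R]_q),
    0 < lambda ->
    systemV F G f g lambda x y y u v omega ->
    jac12 (grad2 (lagr f g omega)) (x, y) = 0 ->
    forall s : 'cV[R]_m,
      0 <=v jac2 g (x, y) *m s - lambda *: g (x, y) ->
      dot omega (jac2 g (x, y) *m s) = 0 ->
      exists t : 'cV[R]_q, systemK F G f g lambda x y omega s u v t).
Proof.
have [[df _] [dg _]] := (f_C2.1, g_C2.1).
split=> [lambda x y omega s u v t _ [st lower mult cu cv cw] comp hess|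
         lambda x y u v omega _ [st lower cu cv cw] hess s s_ge0 s_orth].
(* With [z := y], the last block of V takes the sign of [omega] from the [w] block of K, feasibility
   from its [v] block, and complementarity from [comp]. *)
- split=> //; last by case: cw cv => _ ? _ [_ ? _].
  rewrite (col_mx_grad1_lagr (df _) (dg _) lower) -st hess trmx0 mul0mx addr0.
  (* The two [lambda *: grad12 f] terms of V cancel; the remaining [omega] term is what K absorbs
     into [v - lambda *: omega]. *)
  by rewrite mulmxBr -scalemxAr scalerDr opprD !addrA addrK.
- exists (lambda *: g (x, y) - jac2 g (x, y) *m s); split=> //.
  + rewrite -[RHS]st (col_mx_grad1_lagr (df _) (dg _) lower) hess trmx0 mul0mx.
    rewrite addr0 mulmxBr -scalemxAr scalerDr opprD.
    by rewrite !addrA addrK.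
  + by rewrite (addrC (- _)) subrKA subrr.
  (* The sign of [t] is [s_ge0] negated. In the product of [t] and [omega], the [g] term vanishes by
     complementarity in V and the [s] term by [s_orth]. *)
  + case: cw => omega_ge0 _ comp; split=> //.
      by move=> i; have := s_ge0 i; rewrite !mxE subr_ge0 subr_le0.
    rewrite dotC /dot mulmxBr -scalemxAr mxE [X in X + _]mxE [X in _ + X]mxE.
    by rewrite -!/(dot _ _) comp s_orth mulr0 subr0.
Qed.
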